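(* Assume the standing assumptions below and let $X_*$ be the unique symmetric positive semidefinite solution of $\mathscr R(X)=0$, where $\mathscr R(X)=A^{\mathsf T}X+XA+Q+\Pi_{11}(X)-[XB+L+\Pi_{12}(X)][R+\Pi_{22}(X)]^{-1}[XB+L+\Pi_{12}(X)]^{\mathsf T}$. Consider the modified Newton iteration: given symmetric $X_0$, for $k\ge0$ let $X_{k+1}$ be the solution of $$\widehat A_k^{\mathsf T}X_{k+1}+X_{k+1}\widehat A_k+\widehat\Pi_k(X_k)+M_k=0,$$ with $R_k=R+\Pi_{22}(X_k)$, $S_k=X_kB+L+\Pi_{12}(X_k)$, $\widehat A_k=A-BR_k^{-1}S_k^{\mathsf T}$, $P_k=\begin{bmatrix}I_n\\-R_k^{-1}S_k^{\mathsf T}\end{bmatrix}$, $\widehat\Pi_k(X)=P_k^{\mathsf T}\Pi(X)P_k$, $M_k=P_k^{\mathsf T}\begin{bmatrix}Q&L\\L^{\mathsf T}&R\end{bmatrix}P_k$. Suppose $X_0\succeq X_*$, $A_{\mathrm c}(X_0)-G_{\mathrm c}(X_0)X_0$ has all eigenvalues in the open left half-plane, and $\mathscr R(X_0)\preceq0$. If the sequence $\{X_k\}$ exists and $X_k\succeq0$ for all $k$, then (a) $X_0\succeq X_1\succeq\cdots\succeq X_k\succeq X_*$ and $\mathscr R(X_k)\preceq0$ for $k\ge0$; (b) $\lim_{k\to\infty}X_k=X_*$.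
   Context: Data: $A,Q\in\mathbb{R}^{n\times n}$, $B,L\in\mathbb{R}^{n\times m}$, $R\in\mathbb{R}^{m\times m}$, $A_0^i\in\mathbb{R}^{n\times n}$, $B_0^i\in\mathbb{R}^{n\times m}$ ($i=1,\dots,r$); $A_0^0=A$, $B_0^0=B$. For symmetric $X$: $\Pi(X)=\begin{bmatrix}\Pi_{11}(X)&\Pi_{12}(X)\\\Pi_{12}(X)^{\mathsf T}&\Pi_{22}(X)\end{bmatrix}$ with $\Pi_{11}(X)=\sum_{i=1}^r (A_0^i)^{\mathsf T}XA_0^i$, $\Pi_{12}(X)=\sum_i (A_0^i)^{\mathsf T}XB_0^i$, $\Pi_{22}(X)=\sum_i (B_0^i)^{\mathsf T}XB_0^i$; $L_{\mathrm c}=L+\Pi_{12}$, $R_{\mathrm c}=R+\Pi_{22}$; $A_{\mathrm c}(X)=A-BR_{\mathrm c}(X)^{-1}L_{\mathrm c}(X)^{\mathsf T}$, $G_{\mathrm c}(X)=BR_{\mathrm c}(X)^{-1}B^{\mathsf T}$. Standing assumptions: (1) $R\succ0$, $\begin{bmatrix}Q&L\\L^{\mathsf T}&R\end{bmatrix}\succeq0$; (2) there is $F\in\mathbb{R}^{m\times n}$ with $\dot S=(A+BF)S+S(A+BF)^{\mathsf T}+\sum_{i=1}^r(A_0^i+B_0^iF)S(A_0^i+B_0^iF)^{\mathsf T}$ exponentially stable; (3) with $C^{\mathsf T}C=Q-LR^{-1}L^{\mathsf T}$, $C\in\mathbb{R}^{p\times n}$, and $\widetilde A_0^i=A_0^i-B_0^iR^{-1}L^{\mathsf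 T}$, there is $K\in\mathbb{R}^{n\times p}$ with $\dot S=(\widetilde A_0^0+KC)S+S(\widetilde A_0^0+KC)^{\mathsf T}+\sum_{i=1}^r\widetilde A_0^iS(\widetilde A_0^i)^{\mathsf T}$ exponentially stable; (4) $\mathcal N(Q-LR^{-1}L^{\mathsf T})\subseteq\mathcal N(L^{\mathsf T})\cap\bigcap_i\mathcal N(A_0^i)$; (5) $(A,B)$ stabilizable and $(Q-LR^{-1}L^{\mathsf T},A)$ detectable. Under (1)–(3), $\mathscr R(X)=0$ has a unique positive semidefinite solution $X_*$, which is stabilizing. *)

(* Defs.v *)
From HB Require Import structures.
From mathcomp Require Import all_boot all_order all_algebra.
From mathcomp Require Import all_classical all_reals all_analysis.
From mathcomp Require Import complex.
Set Implicit Arguments. Unset Strict Implicit. Unset Printing Implicit Defensive.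
Import Order.TTheory GRing.Theory Num.Theory.
Import numFieldNormedType.Exports.
Local Open Scope ring_scope.

Section Defs.
Variable R : realType.

Definition symm n (M : 'M[R]_n) : Prop := M^T = M.

Definition psd n (M : 'M[R]_n) : Prop :=
  symm M /\ forall x : 'cV[R]_n, 0 <= (x^T *m M *m x) 0 0.

Definition pd n (M : 'M[R]_n) : Prop :=
  symm M /\ forall x : 'cV[R]_n, x != 0 -> 0 < (x^T *m M *m x) 0 0.

Definition loewner_le n (X Y : 'M[R]_n) : Prop := psd (Y - X).

Definition hurwitz n (M : 'M[R]_n) : Prop :=
  forall z : R[i], root (char_poly (map_mx (fun x : R => (x%:C)%C) M)) z ->
    complex.Re z < 0.

Definition exp_stable n (Lop : 'M[R]_n -> 'M[R]_n) : Prop :=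
  exists c : R, exists beta : R, 0 < beta /\
    forall S : R -> 'M[R]_n,
      (forall t, derivable S t 1 /\ derive1 S t = Lop (S t)) ->
      forall t, 0 <= t -> `|S t| <= c * expR (- (beta * t)) * `|S 0|.

Variables (n m r : nat).
Variables (A Q : 'M[R]_n) (B L : 'M[R]_(n, m)) (Rm : 'M[R]_m)
          (A0 : 'I_r -> 'M[R]_n) (B0 : 'I_r -> 'M[R]_(n, m)).
(* A0 i, B0 i stand for A_0^{i+1}, B_0^{i+1}, i = 0..r-1 *)

Definition Pi11 (X : 'M[R]_n) : 'M[R]_n := \sum_(i < r) (A0 i)^T *m X *m A0 i.
Definition Pi12 (X : 'M[R]_n) : 'M[R]_(n, m) := \sum_(i < r) (A0 i)^T *m X *m B0 i.
Definition Pi22 (X : 'M[R]_n) : 'M[R]_m := \sum_(i < r) (B0 i)^T *m X *m B0 i.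
Definition PiM (X : 'M[R]_n) : 'M[R]_(n + m) :=
  block_mx (Pi11 X) (Pi12 X) (Pi12 X)^T (Pi22 X).

Definition Lc (X : 'M[R]_n) : 'M[R]_(n, m) := L + Pi12 X.
Definition Rc (X : 'M[R]_n) : 'M[R]_m := Rm + Pi22 X.
Definition Ac (X : 'M[R]_n) : 'M[R]_n := A - B *m invmx (Rc X) *m (Lc X)^T.
Definition Gc (X : 'M[R]_n) : 'M[R]_n := B *m invmx (Rc X) *m B^T.

Definition Riccati (X : 'M[R]_n) : 'M[R]_n :=
  A^T *m X + X *m A + Q + Pi11 X
  - (X *m B + L + Pi12 X) *m invmx (Rm + Pi22 X) *m (X *m B + L + Pi12 X)^T.

Definition Rk (Xk : 'M[R]_n) : 'M[R]_m := Rm + Pi22 Xk.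
Definition Sk (Xk : 'M[R]_n) : 'M[R]_(n, m) := Xk *m B + L + Pi12 Xk.
Definition Ahat (Xk : 'M[R]_n) : 'M[R]_n := A - B *m invmx (Rk Xk) *m (Sk Xk)^T.
Definition Pk (Xk : 'M[R]_n) : 'M[R]_(n + m, n) :=
  col_mx 1%:M (- (invmx (Rk Xk) *m (Sk Xk)^T)).
Definition Pihat (Xk X : 'M[R]_n) : 'M[R]_n := (Pk Xk)^T *m PiM X *m Pk Xk.
Definition Mk (Xk : 'M[R]_n) : 'M[R]_n :=
  (Pk Xk)^T *m block_mx Q L L^T Rm *m Pk Xk.

Definition newton_step (Xk X' : 'M[R]_n) : Prop :=
  (Ahat Xk)^T *m X' + X' *m Ahat Xk + Pihat Xk Xk + Mk Xk = 0.

Definition assumption1 : Prop := pd Rm /\ psd (block_mx Q L L^T Rm).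

Definition assumption2 : Prop :=
  exists F : 'M[R]_(m, n),
    exp_stable (fun S : 'M[R]_n =>
      (A + B *m F) *m S + S *m (A + B *m F)^T
      + \sum_(i < r) (A0 i + B0 i *m F) *m S *m (A0 i + B0 i *m F)^T).

Definition Qtilde : 'M[R]_n := Q - L *m invmx Rm *m L^T.
Definition Atilde (i : 'I_r) : 'M[R]_n := A0 i - B0 i *m invmx Rm *m L^T.
Definition Atilde0 : 'M[R]_n := A - B *m invmx Rm *m L^T.

Definition assumption3 : Prop :=
  exists p : nat, exists C : 'M[R]_(p, n), C^T *m C = Qtilde /\
    exists K : 'M[R]_(n, p),
      exp_stable (fun S : 'M[R]_n =>
        (Atilde0 + K *m C) *m S + S *m (Atilde0 + K *m C)^T
        + \sum_(i < r) Atilde i *m S *m (Atilde i)^T).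

Definition assumption4 : Prop :=
  forall x : 'cV[R]_n, Qtilde *m x = 0 ->
    L^T *m x = 0 /\ forall i : 'I_r, A0 i *m x = 0.

(* (A,B) stabilizable; (Qtilde, A) detectable *)
Definition assumption5 : Prop :=
  (exists F : 'M[R]_(m, n), hurwitz (A + B *m F)) /\
  (exists K : 'M[R]_n, hurwitz (A + K *m Qtilde)).

End Defs.

(* Main.v *)
(* For a feedback gain F let Phi F X = lyap (A + B F) X + clPi F X + cost F, an
   affine map of X.  Completing the square gives
     Phi F X = Ric X + (F - gain X)^T (R + Pi22 X) (F - gain X),
   so Ric X is the Loewner minimum over F of Phi F X, and the Newton step reads
   lyap (A + B gain X_k) (X_k - X_{k+1}) = Ric X_k.  If X >= 0 and Ric X <= 0
   then A + B gain X is Hurwitz: an eigenvector with Re >= 0 has zero running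
   cost, hence by (4) zero feedback, which contradicts detectability (5).
   Lyapunov's theorem then gives the monotonicity, and the limit Y of the
   decreasing sequence satisfies Phi (gain Xs) Y >= 0.  For D = Y - Xs this is
   lyap D + clPi D >= 0.  Since (4) bounds clPi by a multiple of the running
   cost, a bound D <= t Xs improves to D <= theta t Xs with a fixed theta < 1,
   whence D = 0. *)
Require Import Defs.
From HB Require Import structures.
From mathcomp Require Import all_boot all_order all_algebra.
From mathcomp Require Import all_classical all_reals all_analysis.
From mathcomp Require Import complex ring lra.
Import Order.TTheory GRing.Theory Num.Theory.
Import numFieldNormedType.Exports.
Local Open Scope classical_set_scope.
Local Open Scope ring_scope.

Local Notation "M ^h" := (map_mx (@Num.conj _) M^T)
  (at level 8, format "M ^h") : ring_scope.

(** * Entrywise rules for matrix sums and multiples *)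

Section Entries.
Variables (K : pzRingType) (m n : nat).
Implicit Types M N : 'M[K]_(m, n).

(* Unlike [mxE], these do not unfold the entries of a matrix product. *)
Lemma mxaddE M N i j : (M + N) i j = M i j + N i j. Proof. exact: mxE. Qed.
Lemma mxoppE M i j : (- M) i j = - M i j. Proof. exact: mxE. Qed.
Lemma mxscaleE c M i j : (c *: M) i j = c * M i j. Proof. exact: mxE. Qed.

End Entries.

(** * Hermitian positive semidefinite matrices and the complex Lyapunov theorem *)

Section Hermitian.
Set Implicit Arguments. Unset Strict Implicit.
Variable C : numClosedFieldType.

Lemma hconjK m n (M : 'M[C]_(m, n)) : M^h^h = M.
Proof. by apply/matrixP => i j; rewrite !mxE conjCK. Qed.

Lemma hconjM m n p (M : 'M[C]_(m, n)) (N : 'M[C]_(n, p)) :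
  (M *m N)^h = N^h *m M^h.
Proof. by rewrite trmx_mul map_mxM. Qed.

Lemma hconjD m n (M N : 'M[C]_(m, n)) : (M + N)^h = M^h + N^h.
Proof. by rewrite linearD map_mxD. Qed.

Lemma hconjN m n (M : 'M[C]_(m, n)) : (- M)^h = - M^h.
Proof. by rewrite linearN map_mxN. Qed.

Lemma hconj_col m1 m2 n (M : 'M[C]_(m1, n)) (N : 'M[C]_(m2, n)) :
  (col_mx M N)^h = row_mx M^h N^h.
Proof. by rewrite tr_col_mx map_row_mx. Qed.

Lemma hconj_row m n1 n2 (M : 'M[C]_(m, n1)) (N : 'M[C]_(m, n2)) :
  (row_mx M N)^h = col_mx M^h N^h.
Proof. by rewrite tr_row_mx map_col_mx. Qed.

Definition hpsd n (M : 'M[C]_n) : Prop :=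
  M^h = M /\ forall x : 'cV[C]_n, 0 <= (x^h *m M *m x) 0 0.

Lemma hpsd_congr m n (M : 'M[C]_n) (P : 'M[C]_(m, n)) :
  hpsd M -> hpsd (P *m M *m P^h).
Proof.
move=> [hM pM]; split=> [|x]; first by rewrite !hconjM hconjK hM mulmxA.
have -> : x^h *m (P *m M *m P^h) *m x = (P^h *m x)^h *m M *m (P^h *m x).
  by rewrite hconjM hconjK !mulmxA.
exact: pM.
Qed.

Lemma hpsdD n (M N : 'M[C]_n) : hpsd M -> hpsd N -> hpsd (M + N).
Proof.
move=> [hM pM] [hN pN]; split=> [|x]; first by rewrite hconjD hM hN.
by rewrite mulmxDr mulmxDl mxE addr_ge0.
Qed.

Lemma hpsd_scalar n (c : C) : 0 <= c -> hpsd (c%:M : 'M[C]_n).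
Proof.
move=> c0; split=> [|x].
  by rewrite tr_scalar_mx map_scalar_mx /= geC0_conj.
rewrite mul_mx_scalar -scalemxAl mxE mulr_ge0 // mxE sumr_ge0 // => i _.
by rewrite !mxE mulrC mul_conjC_ge0.
Qed.

(** If [w = M u] were nonzero, the form would be negative at [s u - w] for large [s], since its
    quadratic term in [s] vanishes. *)
Lemma hpsd_ker n (M : 'M[C]_n) (u : 'cV[C]_n) :
  hpsd M -> (u^h *m M *m u) 0 0 = 0 -> M *m u = 0.
Proof.
move=> [hM pM] uMu; have [w defw] : {w | w = M *m u} by exists (M *m u).
have wE : w^h = u^h *m M by rewrite defw hconjM hM.
rewrite -defw.
have [->//|w0] := eqVneq w 0.
have ww : 0 < (w^h *m w) 0 0.
  have [i wi] : exists i, w i 0 != 0.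
    apply/existsP; rewrite -negb_forall; apply: contra w0 => /forallP w0.
    by apply/eqP/matrixP => i j; rewrite ord1 [RHS]mxE; apply/eqP.
  rewrite mxE (bigD1 i) //= ltr_wpDr //.
    by rewrite sumr_ge0 // => j _; rewrite !mxE mulrC mul_conjC_ge0.
  by rewrite !mxE mulrC mul_conjC_gt0.
set g := (w^h *m M *m w) 0 0; have g0 : 0 <= g by exact: pM.
(* This [s] makes the value at [s u - w] equal to [- 2 (g + 1) + g = - (g + 2) < 0]. *)
set s := (g + 1) / (w^h *m w) 0 0.
have sR : s^* = s by rewrite geC0_conj // divr_ge0 ?ltW // ltr_wpDl.
have := pM (s *: u - w).
have -> : (s *: u - w)^h *m M *m (s *: u - w) =
    (s ^+ 2) *: (u^h *m M *m u) - (s *+ 2) *: (w^h *m w) + w^h *m M *m w.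
  rewrite hconjD hconjN linearZ /= map_mxZ /= sR.
  rewrite mulmxDr !mulmxDl !mulmxN !mulNmx -!scalemxAl -!scalemxAr.
  have -> : u^h *m M *m w = w^h *m w by rewrite wE.
  have -> : w^h *m M *m u = w^h *m w by rewrite -mulmxA -defw.
  by rewrite scalerA -expr2 opprK mulr2n scalerDl opprD !addrA.
rewrite !(mxaddE, mxoppE, mxscaleE) uMu mulr0 add0r.
rewrite -/g -mulr_natl -mulrA [(g + 1) / _ * _]divfK ?gt_eqF //.
have -> : - (2 * (g + 1)) + g = - (g + 2) by ring.
by rewrite oppr_ge0 => /le_gtF; rewrite ltr_wpDl.
Qed.


Lemma hconj_scalar n (c : C) : (c%:M : 'M[C]_n)^h = (c^*)%:M.
Proof. by rewrite tr_scalar_mx map_scalar_mx. Qed.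

Lemma hconj1 n : (1%:M : 'M[C]_n)^h = 1%:M.
Proof. by rewrite hconj_scalar rmorph1. Qed.

Lemma hconj0 m n : (0 : 'M[C]_(m, n))^h = 0.
Proof. by rewrite trmx0 map_mx0. Qed.

(* One elimination step: with z the corner of X and y the column below it,
   X = z^-1 [z; y] [z; y]^h + diag(0, S), where the Schur complement S
   satisfies a Lyapunov inequality for the lower right block of A.  If z = 0
   then y = 0, and the same formulas hold because 0^-1 = 0. *)
Lemma lyapunov_trig n (A X : 'M[C]_n) :
  is_trig_mx A -> (forall i, A i i + (A i i)^* < 0) -> X^h = X ->
  hpsd (- (A *m X + X *m A^h)) -> hpsd X.
Proof.
elim: n A X => [|n IH] A X trigA negA hX hQ.
  by split=> // x; rewrite [x]flatmx0 mulmx0 mxE lexx.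
move: A X trigA negA hX hQ; rewrite -[n.+1]/(1 + n)%N => A X.
rewrite -(submxK A) -(submxK X).
move: (ulsubmx A) (ursubmx A) (dlsubmx A) (drsubmx A) => l A0 a A'.
move: (ulsubmx X) (ursubmx X) (dlsubmx X) (drsubmx X) => z yh y X' {A X}.
rewrite is_trig_block_mx // => /and3P[/eqP-> _ trigA'] negA.
rewrite tr_block_mx map_block_mx => /eq_block_mx[hz hyh hy hX'].
have {hyh} {}hy : yh = y^h by rewrite hyh.
rewrite {}hy {yh}.
have negA' i : A' i i + (A' i i)^* < 0.
  by have := negA (rshift 1 i); rewrite block_mxEdr.
have {negA} := negA (lshift n 0); rewrite block_mxEul.
rewrite [l]mx11_scalar [z]mx11_scalar in hz *.
move: (l 0 0) (z 0 0) hz => {}l {}z; rewrite mxE /= mulr1n => hz negl.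
have {}hz : z^* = z.
  by move: hz; rewrite hconj_scalar => /(congr1 (fun M : 'M[C]_1 => M 0 0));
     rewrite !mxE.
set A := block_mx _ 0 a A'; set X := block_mx z%:M _ y X' => hQ.
have hX : X^h = X.
  by rewrite tr_block_mx map_block_mx hX' hconjK hconj_scalar hz.
set e : 'M[C]_(1, 1 + n) := row_mx 1%:M 0.
have eX : e *m X = row_mx z%:M y^h.
  by rewrite mul_row_block !mul1mx !mul0mx !addr0.
have Xe : X *m e^h = col_mx z%:M y.
  by rewrite -[X]hX -hconjM eX hconj_row hconjK hconj_scalar hz.
have eA : e *m A = l *: e.
  by rewrite mul_row_block !mul1mx !mul0mx !addr0 scale_row_mx scaler0 scalemx1.
have eAh : A^h *m e^h = l^* *: e^h by rewrite -hconjM eA linearZ /= map_mxZ.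
have Ae : (A *m X) *m e^h = col_mx (l *: z%:M) (z *: a + A' *m y).
  rewrite -mulmxA Xe mul_block_col mul0mx addr0 mul_scalar_mx.
  by rewrite mul_mx_scalar.
have Qe : (- (A *m X + X *m A^h)) *m e^h =
    - col_mx ((l + l^*) *: z%:M) (z *: a + A' *m y + l^* *: y).
  rewrite mulNmx mulmxDl Ae -[X *m A^h *m _]mulmxA eAh -scalemxAr Xe.
  by rewrite scale_col_mx add_col_mx scalerDl.
have eQe : (e *m (- (A *m X + X *m A^h)) *m e^h) 0 0 = - ((l + l^*) * z).
  rewrite -mulmxA Qe mulmxN mul_row_col mul1mx mul0mx addr0 mxoppE mxscaleE.
  by rewrite mxE mulr1n.
have z0 : 0 <= z.
  have := hQ.2 e^h; rewrite hconjK eQe oppr_ge0 => lz.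
  by move: lz; rewrite nmulr_rle0.
have zy : y = (z^-1 * z) *: y.
  have [z00|zn0] := eqVneq z 0; last by rewrite mulVf // scale1r.
  (* For [z = 0] the form vanishes at [e^h], which therefore lies in the kernel; the lower block of
     this equation is [A' y + l^* y = 0]. *)
  have := hpsd_ker hQ (u := e^h); rewrite hconjK eQe z00 mulr0 oppr0.
  move=> /(_ erefl); rewrite Qe z00 scale0r add0r => /eqP.
  rewrite oppr_eq0 col_mx_eq0 => /andP[_ /eqP Ay].
  (* The matrix is triangular and its diagonal entries [A' i i + l^*] have negative real part. *)
  have unitA' : A' + (l^*)%:M \in unitmx.
    rewrite unitmxE det_trig.
      rewrite unitfE; apply/prodf_neq0 => i _; rewrite mxaddE mxE eqxx mulr1n.
      apply: contraTneq (negA' i) => Al.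
      have -> : A' i i = - l^* by apply/eqP; rewrite -addr_eq0 Al.
      by rewrite rmorphN /= conjCK -opprD oppr_lt0 addrC lt_gtF.
    apply/is_trig_mxP => i j ij; rewrite mxaddE mxE.
    by rewrite -val_eqE ltn_eqF // addr0; apply/is_trig_mxP: i j ij.
  have -> : y = 0; last by rewrite scaler0.
  rewrite -[y](mulKmx unitA') mulmxDl mul_scalar_mx.
  by rewrite Ay mulmx0.
have zyh : y^h = (z^-1 * z) *: y^h.
  by rewrite {1}zy linearZ /= map_mxZ /= rmorphM fmorphV /= hz.
set S := X' - z^-1 *: (y *m y^h).
have XE : X = z^-1 *: (X *m e^h *m (X *m e^h)^h) + block_mx 0 0 0 S.
  rewrite Xe hconj_col mul_col_row hconj_scalar hz scale_block_mx add_block_mx.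
  rewrite !addr0 !mul_scalar_mx mul_mx_scalar !scalerA -zy -zyh.
  rewrite scale_scalar_mx /S [_ *: _ + (_ - _)]addrC subrK; congr (block_mx _%:M _ _ _).
  by have [->|zn0] := eqVneq z 0; rewrite ?mulr0 // mulVf // mul1r.
(* [T] clears the first column of [X]. As [T A = A' T + w e] and [e X T^h = 0], congruence by [T]
   turns the Lyapunov inequality for [A], [X] into the one for [A'], [S]. *)
set T : 'M[C]_(n, 1 + n) := row_mx (- z^-1 *: y) 1%:M.
have TX : T *m X = row_mx 0 S.
  rewrite mul_row_block !mul1mx mul_mx_scalar scalerA mulrN mulrC scaleNr -zy.
  by rewrite addNr -scalemxAl scaleNr addrC.
have TXT : T *m X *m T^h = S.
  rewrite TX hconj_row mul_row_col mul0mx add0r hconj1.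
  by rewrite mulmx1.
have hS : S^h = S by rewrite -TXT [LHS]hconjM [(T *m X)^h]hconjM hconjK hX mulmxA.
have eXT : e *m X *m T^h = 0.
  rewrite -[LHS]hconjK [(e *m X *m T^h)^h]hconjM [(e *m X)^h]hconjM hconjK hX.
  by rewrite mulmxA TX hconj_row mul_row_col mul0mx hconj0 mulmx0 addr0 hconj0.
set w := - z^-1 *: y *m l%:M + a + z^-1 *: (A' *m y).
have TA : T *m A = A' *m T + w *m e.
  rewrite mul_row_block !mul1mx mul_mx_row mulmx1 mul_mx_row mulmx1 !mulmx0.
  rewrite add0r add_row_mx addr0 -scalemxAr /w.
  by congr row_mx; rewrite [RHS]addrC !scaleNr addrK.
move: w TA S XE TX TXT hS => w TA S XE TX TXT hS.
have TAX : T *m (A *m X) *m T^h = A' *m S.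
  rewrite mulmxA TA !mulmxDl -[w *m e *m X]mulmxA -[w *m (e *m X) *m _]mulmxA.
  by rewrite eXT mulmx0 addr0 -!mulmxA [T *m _]mulmxA TXT.
have hpsdS : hpsd S.
  apply: (IH A') => //.
  have -> : - (A' *m S + S *m A'^h) = T *m (- (A *m X + X *m A^h)) *m T^h.
    rewrite mulmxN mulNmx mulmxDr mulmxDl TAX; congr (- (_ + _)).
    rewrite -hS -hconjM -TAX !(hconjM, hconjK) hX.
    by rewrite !mulmxA.
  exact: hpsd_congr.
rewrite XE; apply: hpsdD.
  have -> : z^-1 *: (X *m e^h *m (X *m e^h)^h) =
      (X *m e^h) *m (z^-1)%:M *m (X *m e^h)^h.
    by rewrite mul_mx_scalar scalemxAl.
  by apply: hpsd_congr; apply: hpsd_scalar; rewrite invr_ge0.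
have -> : block_mx 0 0 0 S = col_mx 0 1%:M *m S *m (col_mx 0 1%:M)^h :> 'M[C]_(1 + n).
  rewrite hconj_col hconj0 hconj1 mul_col_mx mul0mx mul1mx.
  by rewrite mul_col_row !mul0mx !mulmx0 mulmx1.
exact: hpsd_congr.
Qed.

(** Schur triangularization reduces this to [lyapunov_trig]: semidefiniteness survives the unitary
    congruence, and the diagonal of the triangular form consists of eigenvalues of [A]. *)
Lemma lyapunov_hermitian n (A X : 'M[C]_n) :
  (forall t, eigenvalue A t -> t + t^* < 0) -> X^h = X ->
  hpsd (- (A *m X + X *m A^h)) -> hpsd X.
Proof.
case: n A X => [|n] A X negA hX hQ.
  by split=> // x; rewrite [x]flatmx0 mulmx0 mxE lexx.
have [P uP] := Schur A isT; rewrite /similar_to /= conjymx // => trigP.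
have PPh : P *m P^h = 1%:M by apply/unitarymxP.
have PhP : P^h *m P = 1%:M by apply: mulmx1C.
have -> : X = P^h *m (P *m X *m P^h) *m P^h^h.
  by rewrite hconjK -!mulmxA PhP mulmx1 mulmxA PhP mul1mx.
apply: hpsd_congr; apply: (lyapunov_trig trigP) => [i||].
- set T := P *m _ *m _; apply: negA.
  have /eigenvalueP[v vT v0] : eigenvalue T (T i i).
    rewrite eigenvalue_root_char char_poly_trig //.
    by apply/rootP; rewrite horner_prod (bigD1 i) //= hornerXsubC subrr mul0r.
  apply/eigenvalueP; exists (v *m P).
    have := congr1 (mulmx^~ P) vT; rewrite /T -!mulmxA PhP mulmx1 !mulmxA => ->.
    by rewrite -scalemxAl.
  by apply: contraNneq v0 => vP; rewrite -[v]mulmx1 -PPh mulmxA vP mul0mx.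
- by rewrite !hconjM hconjK hX mulmxA.
- have -> : - (P *m A *m P^h *m (P *m X *m P^h) +
    P *m X *m P^h *m (P *m A *m P^h)^h) = P *m (- (A *m X + X *m A^h)) *m P^h.
    rewrite !hconjM hconjK mulmxN mulNmx mulmxDr mulmxDl; congr (- (_ + _)).
      by rewrite !mulmxA -[_ *m P^h *m P]mulmxA PhP mulmx1.
    by rewrite !mulmxA -[_ *m P^h *m P]mulmxA PhP mulmx1.
  exact: hpsd_congr.
Qed.

End Hermitian.

(** * Real quadratic forms and bounds between semidefinite matrices *)

Section RealForms.
Set Implicit Arguments. Unset Strict Implicit.
Variable R : realType.

Definition qform m n (M : 'M[R]_(m, n)) (x : 'cV[R]_m) (y : 'cV[R]_n) : R :=
  (x^T *m M *m y) 0 0.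

Section FormTheory.
Variables m n : nat.
Implicit Types (M N : 'M[R]_(m, n)) (x : 'cV[R]_m) (y : 'cV[R]_n).

Lemma qformDl M x x' y : qform M (x + x') y = qform M x y + qform M x' y.
Proof. by rewrite /qform linearD !mulmxDl mxE. Qed.

Lemma qformDr M x y y' : qform M x (y + y') = qform M x y + qform M x y'.
Proof. by rewrite /qform !mulmxDr mxE. Qed.

Lemma qformZl M c x y : qform M (c *: x) y = c * qform M x y.
Proof. by rewrite /qform linearZ /= -!scalemxAl mxE. Qed.

Lemma qformZr M c x y : qform M x (c *: y) = c * qform M x y.
Proof. by rewrite /qform -!scalemxAr mxE. Qed.

Lemma qformNl M x y : qform M (- x) y = - qform M x y.
Proof. by rewrite -scaleN1r qformZl mulN1r. Qed.

Lemma qformNr M x y : qform M x (- y) = - qform M x y.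
Proof. by rewrite -scaleN1r qformZr mulN1r. Qed.

Lemma qformD M N x y : qform (M + N) x y = qform M x y + qform N x y.
Proof. by rewrite /qform mulmxDr mulmxDl mxE. Qed.

Lemma qformN M x y : qform (- M) x y = - qform M x y.
Proof. by rewrite /qform mulmxN mulNmx mxE. Qed.

Lemma qformZ M c x y : qform (c *: M) x y = c * qform M x y.
Proof. by rewrite /qform -scalemxAr -scalemxAl mxE. Qed.

Lemma qform_tr M x y : qform M^T y x = qform M x y.
Proof.
have -> : qform M^T y x = (x^T *m M *m y)^T 0 0; last exact: mxE.
by rewrite !trmx_mul trmxK mulmxA.
Qed.

End FormTheory.

Lemma qformMr m n p (M : 'M[R]_(m, n)) (N : 'M[R]_(n, p)) x y :
  qform (M *m N) x y = qform M x (N *m y).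
Proof. by rewrite /qform !mulmxA. Qed.

Lemma qformMl m n p (M : 'M[R]_(m, n)) (N : 'M[R]_(n, p)) x y :
  qform (M *m N) x y = qform N (M^T *m x) y.
Proof. by rewrite /qform trmx_mul trmxK !mulmxA. Qed.

Lemma qform1_sum n (x y : 'cV[R]_n) : qform 1%:M x y = \sum_i x i 0 * y i 0.
Proof. by rewrite /qform mulmx1 mxE; apply: eq_bigr => i _; rewrite mxE. Qed.

Lemma qform1_ge0 n (x : 'cV[R]_n) : 0 <= qform 1%:M x x.
Proof. by rewrite qform1_sum sumr_ge0 // => i _; rewrite -expr2 sqr_ge0. Qed.

Lemma qform1_eq0 n (x : 'cV[R]_n) : qform 1%:M x x = 0 -> x = 0.
Proof.
rewrite qform1_sum => /psumr_eq0P x0; apply/matrixP => i j; rewrite ord1 mxE.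
by apply/eqP; rewrite -sqrf_eq0 expr2 x0 // => k _; rewrite -expr2 sqr_ge0.
Qed.

Lemma qformC n (M : 'M[R]_n) x y : symm M -> qform M x y = qform M y x.
Proof. by move=> hM; rewrite -{1}hM qform_tr. Qed.

Lemma psd0 n : psd (0 : 'M[R]_n).
Proof. by split=> [|x]; rewrite /symm ?trmx0 // mulmx0 mul0mx mxE. Qed.

Lemma psdD n (M N : 'M[R]_n) : psd M -> psd N -> psd (M + N).
Proof.
move=> [hM pM] [hN pN]; split=> [|x]; first by rewrite /symm linearD /= hM hN.
by rewrite -/(qform _ x x) qformD addr_ge0 // ?pM ?pN.
Qed.

Lemma psdZ n c (M : 'M[R]_n) : 0 <= c -> psd M -> psd (c *: M).
Proof.
move=> c0 [hM pM]; split=> [|x]; first by rewrite /symm linearZ /= hM.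
by rewrite -/(qform _ x x) qformZ mulr_ge0 // pM.
Qed.

Lemma psd_sum n r (M : 'I_r -> 'M[R]_n) :
  (forall i, psd (M i)) -> psd (\sum_i M i).
Proof. by move=> pM; elim/big_ind: _ => [|M1 M2|i _]; [exact: psd0|exact: psdD|]. Qed.

Lemma psd_congr m n (M : 'M[R]_n) (P : 'M[R]_(n, m)) :
  psd M -> psd (P^T *m M *m P).
Proof.
move=> [hM pM]; split=> [|x]; first by rewrite /symm !trmx_mul trmxK hM mulmxA.
by rewrite -/(qform _ x x) qformMr qformMl trmxK; exact: pM.
Qed.

Lemma pd_psd n (M : 'M[R]_n) : pd M -> psd M.
Proof.
move=> [hM pM]; split=> // x; have [->|/pM/ltW//] := eqVneq x 0.
by rewrite mulmx0 mxE.
Qed.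

Lemma pd_unit n (M : 'M[R]_n) : pd M -> M \in unitmx.
Proof.
move=> [hM pM]; rewrite -row_free_unit -kermx_eq0; apply/rowV0P => v.
move=> /sub_kermxP vM; apply/eqP; rewrite -trmx_eq0; apply/negPn/negP => /pM.
by rewrite trmxK vM mul0mx mxE ltxx.
Qed.

Lemma pdD_psd n (M N : 'M[R]_n) : pd M -> psd N -> pd (M + N).
Proof.
move=> [hM pM] [hN pN]; split=> [|x]; first by rewrite /symm linearD /= hM hN.
by move=> /pM x0; rewrite -/(qform _ x x) qformD ltr_wpDr // pN.
Qed.

Lemma psd_ker n (M : 'M[R]_n) x : psd M -> qform M x x = 0 -> M *m x = 0.
Proof.
move=> [hM pM] xMx; apply: qform1_eq0; set w := M *m x.
have wE : qform M w x = qform 1%:M w w by rewrite -qformMr mul1mx.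
have := qform1_ge0 w; rewrite le_eqVlt => /predU1P[//|w0].
have g0 : 0 <= qform M w w by exact: pM.
set s := (qform M w w + 1) / qform 1%:M w w.
have : 0 <= qform M (s *: x - w) (s *: x - w) by exact: pM.
rewrite !(qformDl, qformDr, qformNl, qformNr, qformZl, qformZr) xMx.
rewrite (qformC _ _ hM) wE.
have : s * qform 1%:M w w = qform M w w + 1 by rewrite divfK // gt_eqF.
by nra.
Qed.

Lemma psd_cauchy_schwarz n (M : 'M[R]_n) x y :
  psd M -> qform M x y ^+ 2 <= qform M x x * qform M y y.
Proof.
move=> pM; have [hM _] := pM.
have : 0 <= qform M x x by exact: pM.2.
rewrite le_eqVlt => /predU1P[/esym x0|x0].
  have Mx := psd_ker pM x0.
  have -> : qform M x y = 0; last by rewrite x0 expr0n mul0r.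
  by rewrite (qformC _ _ hM) /qform -mulmxA Mx mulmx0 mxE.
set s := qform M x y / qform M x x.
have : 0 <= qform M (y - s *: x) (y - s *: x) by exact: pM.2.
rewrite !(qformDl, qformDr, qformNl, qformNr, qformZl, qformZr) (qformC y x hM).
have sE : qform M x y = s * qform M x x by rewrite divfK // gt_eqF.
move: s sE => s ->; by nra.
Qed.

(** Cauchy-Schwarz against the [i]-th basis vector bounds the squared [i]-th entry of [M x] by
    [M i i] times the form at [x]; the diagonal sums to the trace. *)
Lemma psd_sqr_le n (M : 'M[R]_n) x :
  psd M -> qform 1%:M (M *m x) (M *m x) <= \tr M * qform M x x.
Proof.
move=> pM; rewrite qform1_sum mulr_suml; apply: ler_sum => i _.
have -> : (M *m x) i 0 = qform M (delta_mx i 0) x.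
  by rewrite /qform trmx_delta -rowE -row_mul [RHS]mxE.
rewrite -expr2; apply: le_trans (psd_cauchy_schwarz _ _ pM) _.
by rewrite /qform trmx_delta -rowE -colE !mxE.
Qed.

Lemma psd_trace_ge0 n (M : 'M[R]_n) : psd M -> 0 <= \tr M.
Proof.
move=> [_ pM]; rewrite sumr_ge0 // => i _; have := pM (delta_mx i 0).
by rewrite trmx_delta -rowE -colE !mxE.
Qed.

(** Obtained by expanding the squared norm of [(tr M + 1) x - M x] and applying [psd_sqr_le]; the
    [+ 1] keeps the factor positive for the final division. *)
Lemma psd_qform_le n (M : 'M[R]_n) x :
  psd M -> qform M x x <= (\tr M + 1) * qform 1%:M x x.
Proof.
move=> pM; have [hM _] := pM; have := psd_trace_ge0 pM; have := psd_sqr_le x pM.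
have e1 : qform 1%:M x (M *m x) = qform M x x by rewrite -qformMr mul1mx.
have e2 : qform 1%:M (M *m x) x = qform M x x by rewrite -qform_tr trmx1 e1.
have := qform1_ge0 ((\tr M + 1) *: x - M *m x); have : 0 <= qform M x x by exact: pM.2.
rewrite !(qformDl, qformDr, qformNl, qformNr, qformZl, qformZr) e1 e2.
move: (\tr M) (qform M x x) (qform _ x x) (qform _ _ (M *m x)) => t g e f.
move=> g0 h f0 t0.
have tp : 0 < t + 1 by rewrite ltr_wpDl.
rewrite -(ler_pM2l tp); nra.
Qed.

(** The kernel inclusion factors [Y] as [Z N]. The form of [Y^T G Y] is then at most a multiple of
    the squared norm of [N x], itself at most [tr N] times the form of [N]. *)
Lemma psd_dominates n p (N : 'M[R]_n) (G : 'M[R]_p) (Y : 'M[R]_(p, n)) :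
  psd N -> psd G -> (forall x : 'cV[R]_n, N *m x = 0 -> Y *m x = 0) ->
  exists2 c : R, 0 <= c & psd (c *: N - Y^T *m G *m Y).
Proof.
move=> pN pG kerN; have [hN _] := pN; have [hG _] := pG.
have : (Y <= N)%MS.
  rewrite submxE; apply/eqP/matrixP => i j; rewrite [RHS]mxE.
  have : Y *m col j (cokermx N) = 0.
    by apply: kerN; rewrite colE mulmxA mulmx_coker mul0mx.
  by rewrite colE mulmxA -colE => /matrixP/(_ i 0); rewrite !mxE.
move=> /submxP[Z ->{Y kerN}].
have pG' := psd_congr Z pG.
exists ((\tr (Z^T *m G *m Z) + 1) * \tr N).
  by rewrite mulr_ge0 ?psd_trace_ge0 // addr_ge0 ?psd_trace_ge0.
split=> [|x].
  by rewrite /symm linearB /= linearZ /= !trmx_mul !trmxK hN hG !mulmxA.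
have e : qform ((Z *m N)^T *m G *m (Z *m N)) x x =
    qform (Z^T *m G *m Z) (N *m x) (N *m x).
  by rewrite /qform !trmx_mul !mulmxA.
rewrite -/(qform _ x x) qformD qformN qformZ e subr_ge0.
apply: le_trans (psd_qform_le _ pG') _; rewrite -mulrA ler_wpM2l //.
  by rewrite addr_ge0 ?psd_trace_ge0.
exact: psd_sqr_le.
Qed.

End RealForms.

(** The eigenvectors behind [eigenvalue] are rows; this invariance carries the spectrum over to
    columns. *)
Lemma char_poly_tr (F : fieldType) n (M : 'M[F]_n) : char_poly M^T = char_poly M.
Proof.
rewrite /char_poly -[RHS]det_tr; congr (\det _).
by apply/matrixP => i j; rewrite !mxE eq_sym.
Qed.

(** * Passage between real matrices and their complexifications *)

Section Complexification.
Set Implicit Arguments. Unset Strict Implicit.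
Variable R : realType.
Local Notation C := R[i].

Local Notation cplx := (map_mx (fun x : R => (x%:C)%C)).

Lemma cplxE m n (M : 'M[R]_(m, n)) : cplx M = map_mx (real_complex R) M.
Proof. by []. Qed.

Lemma hconj_cplx m n (M : 'M[R]_(m, n)) : (cplx M)^h = cplx M^T.
Proof.
by apply/matrixP => i j; rewrite !mxE conj_Creal // complex_real.
Qed.

Lemma cplx_rect m n (x : 'M[C]_(m, n)) :
  exists a b, x = cplx a + 'i%C *: cplx b.
Proof.
exists (map_mx (@complex.Re R) x), (map_mx (@complex.Im R) x).
by apply/matrixP => i j; rewrite !mxE -complexE.
Qed.

(** Real and imaginary parts of the eigenvector equation for [al + i be], so that spectral arguments
    can run on real forms. *)
Lemma cplx_eigenP n (M : 'M[R]_n) (al be : R) (a b : 'cV[R]_n) :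
  cplx M *m (cplx a + 'i%C *: cplx b) = (al +i* be)%C *: (cplx a + 'i%C *: cplx b)
  <-> M *m a = al *: a - be *: b /\ M *m b = be *: a + al *: b.
Proof.
rewrite mulmxDr -scalemxAr !cplxE -!map_mxM -!cplxE.
have key (x y u v : R) :
    x%:C%C + 'i%C * y%:C%C = (al +i* be)%C * (u%:C%C + 'i%C * v%:C%C)
    <-> x = al * u - be * v /\ y = be * u + al * v.
  split=> [/eqP|[-> ->]]; last apply/eqP; rewrite eq_complex /=.
    by move=> /andP[/eqP h1 /eqP h2]; split; lra.
  by apply/andP; split; apply/eqP; ring.
split=> [/matrixP e|[-> ->]].
  by split; apply/matrixP => i j; have := e i j; rewrite !(mxaddE, mxoppE, mxscaleE)
    ![map_mx _ _ _ _]mxE => /key[].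
apply/matrixP => i j; rewrite !(mxaddE, mxoppE, mxscaleE) ![map_mx _ _ _ _]mxE.
by apply/key; rewrite !(mxaddE, mxoppE, mxscaleE).
Qed.

(** For symmetric [M] the cross terms cancel: the Hermitian form at [a + i b] is the sum of the real
    forms at [a] and [b]. *)
Lemma hpsd_cplx n (M : 'M[R]_n) : psd M <-> hpsd (cplx M).
Proof.
split=> [[hM pM]|[hM pM]].
- split=> [|x]; first by rewrite hconj_cplx hM.
  have [a [b ->]] := cplx_rect x.
  have -> : (cplx a + 'i%C *: cplx b)^h = cplx a^T - 'i%C *: cplx b^T.
    rewrite hconjD linearZ /= map_mxZ /= !hconj_cplx -scaleNr.
    by rewrite complexiE conjCi.
  rewrite mulmxBl mulmxBl !mulmxDr -!scalemxAl -!scalemxAr !cplxE -!map_mxM.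
  rewrite !(mxaddE, mxoppE, mxscaleE) ![map_mx _ _ _ _]mxE.
  rewrite -!/(qform _ _ _) (qformC b a hM).
  have ii : 'i%C * 'i%C = -1 :> C by rewrite -expr2 sqr_i.
  rewrite mulrA ii mulN1r opprD opprK addrA addrK.
  by rewrite -rmorphD /= ler0c addr_ge0 // pM.
- split=> [|x].
    move: hM; rewrite hconj_cplx => /matrixP hM; apply/matrixP => i j.
    by have := hM i j; rewrite !mxE => -[].
  have := pM (cplx x); rewrite hconj_cplx !cplxE -!map_mxM mxE.
  by rewrite ler0c.
Qed.

(** With its converse [pair_hurwitz], this replaces complex eigenvectors [a + i b] by real pairs. *)
Lemma hurwitz_pair n (M : 'M[R]_n) (al be : R) (a b : 'cV[R]_n) :
  hurwitz M -> M *m a = al *: a - be *: b -> M *m b = be *: a + al *: b ->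
  (a != 0) || (b != 0) -> al < 0.
Proof.
move=> hM Ma Mb ab0; have := hM (al +i* be)%C; apply.
rewrite -char_poly_tr -eigenvalue_root_char; apply/eigenvalueP.
exists ((cplx a + 'i%C *: cplx b)^T).
  by rewrite -trmx_mul -linearZ; congr trmx; apply/cplx_eigenP.
apply: contraTneq ab0 => /matrixP ab; rewrite negb_or !negbK.
by apply/andP; split; apply/eqP/matrixP => i j; have := ab j i;
  rewrite !mxE => /eqP; rewrite eq_complex /= => /andP[/eqP h1 /eqP h2]; lra.
Qed.

Lemma pair_hurwitz n (M : 'M[R]_n) :
  (forall (al be : R) (a b : 'cV[R]_n), M *m a = al *: a - be *: b ->
    M *m b = be *: a + al *: b -> (a != 0) || (b != 0) -> al < 0) -> hurwitz M.
Proof.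
move=> H z; rewrite -char_poly_tr -eigenvalue_root_char => /eigenvalueP[v].
have [a [b vE]] := cplx_rect v^T => vM v0.
case: z vM => al be /(congr1 trmx); rewrite trmx_mul trmxK linearZ /= vE.
move=> /cplx_eigenP[Ma Mb]; apply: (H al be a b) => //.
rewrite -negb_and; apply: contra v0 => /andP[/eqP a0 /eqP b0].
by rewrite -trmx_eq0 vE a0 b0 !cplxE !map_mx0 scaler0 addr0.
Qed.

(** The complex version is applied to [cplx M^T], whose conjugate transpose is [cplx M]. *)
Lemma lyapunov n (M X : 'M[R]_n) :
  hurwitz M -> symm X -> psd (- (M^T *m X + X *m M)) -> psd X.
Proof.
move=> hM hX /hpsd_cplx hQ; apply/hpsd_cplx.
apply: (@lyapunov_hermitian _ _ (cplx M^T)) => [t||].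
- rewrite eigenvalue_root_char -map_trmx char_poly_tr => /hM t0.
  by rewrite (addcJ t) pmulr_rlt0 // ltcR.
- by rewrite hconj_cplx hX.
- by move: hQ; rewrite hconj_cplx trmxK !cplxE map_mxN map_mxD !map_mxM.
Qed.

End Complexification.

Lemma trmxD (K : pzRingType) m n (M N : 'M[K]_(m, n)) : (M + N)^T = M^T + N^T.
Proof. exact: linearD. Qed.

Lemma square_completion (K : comUnitRingType) m n (M : 'M[K]_m)
    (F : 'M[K]_(m, n)) (S : 'M[K]_(n, m)) : M^T = M -> M \in unitmx ->
  (F + invmx M *m S^T)^T *m M *m (F + invmx M *m S^T) =
  F^T *m M *m F + F^T *m S^T + S *m F + S *m invmx M *m S^T.
Proof.
move=> hM uM; rewrite trmxD trmx_mul trmxK trmx_inv hM mulmxDl mulmxKV //.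
rewrite mulmxDr !mulmxDl !mulmxA mulmxK //.
by apply/matrixP => i j; rewrite !mxaddE; ring.
Qed.

(** * Closed-loop form of the Riccati operator and monotonicity of the Newton step *)

Section RiccatiNewton.
Set Implicit Arguments. Unset Strict Implicit.
Variables (R : realType) (n m r : nat).
Variables (A Q : 'M[R]_n) (B L : 'M[R]_(n, m)) (Rm : 'M[R]_m).
Variables (A0 : 'I_r -> 'M[R]_n) (B0 : 'I_r -> 'M[R]_(n, m)).

Local Notation Ric := (Riccati A Q B L Rm A0 B0).
Local Notation Rk := (Rk Rm B0).
Local Notation Sk := (Sk B L A0 B0).
Local Notation Qt := (Qtilde Q L Rm).

(** With this sign [clA (gain X)] is [Ahat] and [col_mx 1%:M (gain X)] is [Pk], both at [X]. *)
Definition gain (X : 'M[R]_n) : 'M[R]_(m, n) := - (invmx (Rk X) *m (Sk X)^T).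
Definition clA (F : 'M[R]_(m, n)) : 'M[R]_n := A + B *m F.
Definition clA0 (F : 'M[R]_(m, n)) i : 'M[R]_n := A0 i + B0 i *m F.
Definition clPi F (X : 'M[R]_n) : 'M[R]_n := \sum_i (clA0 F i)^T *m X *m clA0 F i.
Definition cost (F : 'M[R]_(m, n)) : 'M[R]_n :=
  Q + L *m F + F^T *m (L^T + Rm *m F).
Definition lyap (M X : 'M[R]_n) : 'M[R]_n := M^T *m X + X *m M.

Definition Phi F (X : 'M[R]_n) : 'M[R]_n := lyap (clA F) X + clPi F X + cost F.

Lemma lyapD M X Y : lyap M (X + Y) = lyap M X + lyap M Y.
Proof. by rewrite /lyap mulmxDr mulmxDl addrACA. Qed.

Lemma lyapN M X : lyap M (- X) = - lyap M X.
Proof. by rewrite /lyap mulmxN mulNmx opprD. Qed.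

Lemma lyapZ M c X : lyap M (c *: X) = c *: lyap M X.
Proof. by rewrite /lyap -scalemxAr -scalemxAl scalerDr. Qed.

(** Changing the gain only adds cross terms in [F - G]; this relates the varying gains of the
    iterates to one fixed gain. *)
Lemma lyap_clA F G D : D^T = D -> lyap (clA F) D =
  lyap (clA G) D + D *m B *m (F - G) + (F - G)^T *m (D *m B)^T.
Proof.
move=> hD; have -> : (F - G)^T = F^T - G^T by rewrite linearB.
rewrite /lyap /clA !(trmxD, trmx_mul, mulmxDl, mulmxDr) hD.
rewrite !(mulmxN, mulNmx) !mulmxA.
by apply/matrixP => i j; rewrite !(mxaddE, mxoppE); ring.
Qed.

Lemma clPiD F X Y : clPi F (X + Y) = clPi F X + clPi F Y.
Proof.
rewrite /clPi -big_split; apply: eq_bigr => i _ /=.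
by rewrite [_ *m (X + Y)]mulmxDr mulmxDl.
Qed.

Lemma clPiN F X : clPi F (- X) = - clPi F X.
Proof. by rewrite /clPi -sumrN; apply: eq_bigr => i _; rewrite mulmxN mulNmx. Qed.

Lemma clPiZ F c X : clPi F (c *: X) = c *: clPi F X.
Proof.
by rewrite /clPi scaler_sumr; apply: eq_bigr => i _; rewrite -scalemxAr -scalemxAl.
Qed.

Lemma clPi_psd F X : psd X -> psd (clPi F X).
Proof. by move=> pX; apply: psd_sum => i; apply: psd_congr. Qed.

Lemma graph_form (F : 'M[R]_(m, n)) (a : 'M[R]_n) (b : 'M[R]_(n, m)) c d :
  (col_mx 1%:M F)^T *m block_mx a b c d *m col_mx 1%:M F =
  a + b *m F + F^T *m (c + d *m F).
Proof.
rewrite -mulmxA mul_block_col !mulmx1 tr_col_mx mul_row_col trmx1.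
by rewrite mul1mx.
Qed.

Lemma cost_graph F : cost F =
  (col_mx 1%:M F)^T *m block_mx Q L L^T Rm *m col_mx 1%:M F.
Proof. by rewrite graph_form. Qed.

Lemma clPiE F X : symm X ->
  clPi F X = Pi11 A0 X + Pi12 A0 B0 X *m F
             + F^T *m ((Pi12 A0 B0 X)^T + Pi22 B0 X *m F).
Proof.
move=> hX; rewrite /clPi /Pi11 /Pi12 /Pi22 mulmxDr linear_sum !mulmx_suml.
rewrite !mulmx_sumr -!big_split /=; apply: eq_bigr => i _.
rewrite /clA0 trmxD !trmx_mul trmxK hX !mulmxDl !mulmxDr !mulmxA.
by apply/matrixP => k l; rewrite !mxaddE; ring.
Qed.

Lemma PihatE X Y : symm Y -> Pihat B L Rm A0 B0 X Y = clPi (gain X) Y.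
Proof. by move=> hY; rewrite clPiE // /Pihat graph_form. Qed.

(** [Pihat] is taken at the old iterate [X], so the step is a plain Lyapunov equation in [Y]. *)
Lemma newton_stepE X Y : symm X -> newton_step A Q B L Rm A0 B0 X Y ->
  lyap (clA (gain X)) Y = - (clPi (gain X) X + cost (gain X)).
Proof.
move=> hX; rewrite /newton_step PihatE // -[Mk _ _ _ _ _ _ X]cost_graph.
rewrite -[Ahat _ _ _ _ _ _ X]/(A - _) /lyap /clA mulmxN mulmxA -addrA.
by move/eqP; rewrite addr_eq0 => /eqP.
Qed.

Lemma Pi22_psd X : psd X -> psd (Pi22 B0 X).
Proof. by move=> pX; apply: psd_sum => i; apply: psd_congr. Qed.

Hypothesis posR : pd Rm.
Hypothesis posW : psd (block_mx Q L L^T Rm).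

Lemma Rk_pd X : psd X -> pd (Rk X).
Proof. by move=> pX; apply/pdD_psd/Pi22_psd. Qed.

Lemma Phi_square F X : psd X ->
  Phi F X = Ric X + (F - gain X)^T *m Rk X *m (F - gain X).
Proof.
move=> pX; have [hX _] := pX; have [hRk _] := Rk_pd pX.
have uRk := pd_unit (Rk_pd pX).
have -> : Ric X = A^T *m X + X *m A + Q + Pi11 A0 X
    - Sk X *m invmx (Rk X) *m (Sk X)^T by [].
have -> : (F - gain X)^T *m Rk X *m (F - gain X) =
    F^T *m Rk X *m F + F^T *m (Sk X)^T + Sk X *m F
    + Sk X *m invmx (Rk X) *m (Sk X)^T.
  by rewrite /gain opprK; exact: square_completion.
rewrite /Phi /lyap /clA /cost clPiE // /Defs.Sk /Defs.Rk.
rewrite !(trmxD, trmx_mul, mulmxDl, mulmxDr) hX !mulmxA.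
apply/matrixP => i j; rewrite !(mxaddE, mxoppE); ring.
Qed.

Lemma Phi_gain X : psd X -> Phi (gain X) X = Ric X.
Proof. by move=> pX; rewrite Phi_square // subrr mulmx0 addr0. Qed.

Lemma cost_psd F : psd (cost F).
Proof. by rewrite cost_graph; apply: psd_congr. Qed.

Hypothesis kerQ : assumption4 Q L Rm A0.

(** Zero cost puts [[x; F x]] in the kernel of the weight matrix. Its second block gives
    [F x = - Rm^-1 L^T x], the first then reads [Qt x = 0], and [kerQ] yields [L^T x = 0] and
    [A0 i x = 0]. *)
Lemma cost_ker F x : qform (cost F) x x = 0 ->
  [/\ F *m x = 0, Qt *m x = 0 & forall i, A0 i *m x = 0].
Proof.
have uR := pd_unit posR.
rewrite cost_graph qformMr qformMl trmxK => /(psd_ker posW).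
rewrite [col_mx 1%:M F *m x]mul_col_mx mul1mx mul_block_col => /eqP.
rewrite col_mx_eq0 => /andP[/eqP Qx /eqP Lx].
have Fx : F *m x = - (invmx Rm *m (L^T *m x)).
  apply/eqP; rewrite -addr_eq0 addrC.
  by rewrite -[F *m x](mulKmx uR) -mulmxDr Lx mulmx0.
have Qtx : Qt *m x = 0.
  by rewrite -Qx Fx mulmxN mulmxBl !mulmxA.
have [Ltx A0x] := kerQ Qtx.
by split=> //; rewrite Fx Ltx mulmx0 oppr0.
Qed.

Hypothesis detQ : exists K : 'M[R]_n, hurwitz (A + K *m Qt).

Lemma gain_hurwitz X : psd X -> psd (- Ric X) -> hurwitz (clA (gain X)).
Proof.
move=> pX pRic; have [hX _] := pX; set F := gain X.
apply: pair_hurwitz => al be a b Ma Mb ab0.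
rewrite ltNge; apply/negP => al0.
have lyapE x : qform (lyap (clA F) X) x x = 2 * qform X x (clA F *m x).
  rewrite /lyap qformD qformMl trmxK qformMr [qform X (_ *m _) x]qformC //.
  by ring.
have h x : 0 <= - (2 * qform X x (clA F *m x) + qform (clPi F X) x x
    + qform (cost F) x x).
  by rewrite -lyapE -!qformD -qformN -/(Phi F X) Phi_gain //; exact: pRic.2.
have pPi x : 0 <= qform (clPi F X) x x by exact: (clPi_psd F pX).2.
have pC x : 0 <= qform (cost F) x x by exact: (cost_psd F).2.
have pXx x : 0 <= qform X x x by exact: pX.2.
(* Adding the inequalities at [a] and [b] cancels the [be] terms by symmetry of [X]; a sum of
   nonnegative terms remains, and it is at most 0. *)
have [Ca Cb] : qform (cost F) a a = 0 /\ qform (cost F) b b = 0.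
  have := h a; have := h b; rewrite Ma Mb !(qformDr, qformZr, qformNr).
  rewrite (qformC b a hX).
  have := mulr_ge0 al0 (pXx a); have := mulr_ge0 al0 (pXx b).
  move: (pPi a) (pPi b) (pC a) (pC b); split; lra.
have [Fa Qa _] := cost_ker Ca; have [Fb Qb _] := cost_ker Cb.
have [K hK] := detQ.
(* Both [F] and [Qt] vanish on [a] and [b], so [clA F] and [A + K Qt] agree there. *)
have : al < 0; last by rewrite ltNge al0.
apply: (hurwitz_pair (be := be) (a := a) (b := b) hK) => //.
  by rewrite mulmxDl -mulmxA Qa mulmx0 addr0 -Ma mulmxDl -mulmxA Fa mulmx0 addr0.
by rewrite mulmxDl -mulmxA Qb mulmx0 addr0 -Mb mulmxDl -mulmxA Fb mulmx0 addr0.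
Qed.

(** Explicit semidefinite expressions: [- lyap (clA F)] is [- Ric X] at [X - Y], and
    [clPi F (X - Xs)] plus a square at [Y - Xs]; [- Ric Y] is [clPi F (X - Y)] plus a square. The
    squares come from [Phi_square] at [Xs] and [Y]. *)
Lemma newton_monotone Xs X Y : psd Xs -> Ric Xs = 0 -> psd X -> psd Y ->
  psd (X - Xs) -> psd (- Ric X) -> newton_step A Q B L Rm A0 B0 X Y ->
  [/\ psd (X - Y), psd (Y - Xs) & psd (- Ric Y)].
Proof.
move=> pXs Xs0 pX pY pXXs pRic step.
have hF := gain_hurwitz pX pRic.
have stepE := newton_stepE pX.1 step.
have hXY : symm (X - Y) by rewrite /symm linearB /= pX.1 pY.1.
have hYXs : symm (Y - Xs) by rewrite /symm linearB /= pXs.1 pY.1.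
set F := gain X in hF stepE.
have pXY : psd (X - Y).
  apply: (lyapunov hF) => //; rewrite -/(lyap _ _) lyapD lyapN stepE.
  have -> // : lyap (clA F) X - - (clPi F X + cost F) = Ric X.
  by rewrite opprK addrA -Phi_gain.
have sq Z : psd Z -> psd ((F - gain Z)^T *m Rk Z *m (F - gain Z)).
  by move=> pZ; apply/psd_congr/pd_psd/Rk_pd.
split; first exact: pXY.
  apply: (lyapunov hF) => //; rewrite -/(lyap _ _) lyapD lyapN stepE.
  have := Phi_square F pXs; rewrite Xs0 add0r => PhiXs.
  have -> : - (- (clPi F X + cost F) - lyap (clA F) Xs) =
      clPi F (X - Xs) + Phi F Xs.
    rewrite clPiD clPiN /Phi; apply/matrixP => i j.
    by rewrite !(mxaddE, mxoppE); ring.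
  by rewrite PhiXs; apply: psdD; [apply: clPi_psd|apply: sq].
have -> : - Ric Y = clPi F (X - Y) + (F - gain Y)^T *m Rk Y *m (F - gain Y).
  have := Phi_square F pY; rewrite /Phi stepE clPiD clPiN => /esym/(canRL (addrK _)) ->.
  by apply/matrixP => i j; rewrite !(mxaddE, mxoppE); ring.
by apply: psdD; [apply: clPi_psd|apply: sq].
Qed.

End RiccatiNewton.

(** * Entrywise limits of matrix sequences *)

Section EntrywiseLimits.
Set Implicit Arguments. Unset Strict Implicit.
Variable R : realType.

(** This form reduces matrix limits to real ones; [entry_cvg_cvg] returns to the matrix topology. *)
Definition entry_cvg m n (X : nat -> 'M[R]_(m, n)) (Y : 'M[R]_(m, n)) : Prop :=
  forall i j, (fun k => X k i j) @ \oo --> Y i j.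

Lemma entry_cvg_cvg m n (X : nat -> 'M[R]_(m, n)) Y :
  entry_cvg X Y -> X @ \oo --> Y.
Proof.
move=> XY S [P nP sPS].
have : \forall k \near \oo, forall i j, P i j (X k i j).
  by apply: filter_forall => i; apply: filter_forall => j; apply: XY; exact: nP.
by apply: filterS => k; exact: sPS.
Qed.

Lemma entry_cvg_unique m n (X : nat -> 'M[R]_(m, n)) Y Z :
  entry_cvg X Y -> entry_cvg X Z -> Y = Z.
Proof.
move=> XY XZ; apply/matrixP => i j.
exact: (cvg_unique _ (XY i j) (XZ i j)).
Qed.

Lemma entry_cvg_cst m n (Y : 'M[R]_(m, n)) : entry_cvg (fun=> Y) Y.
Proof. by move=> i j; exact: cvg_cst. Qed.

Lemma entry_cvgD m n (X X' : nat -> 'M[R]_(m, n)) Y Y' :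
  entry_cvg X Y -> entry_cvg X' Y' -> entry_cvg (fun k => X k + X' k) (Y + Y').
Proof.
move=> XY XY' i j; rewrite mxE; under eq_cvg do rewrite mxE.
exact: cvgD.
Qed.

Lemma entry_cvgN m n (X : nat -> 'M[R]_(m, n)) Y :
  entry_cvg X Y -> entry_cvg (fun k => - X k) (- Y).
Proof. by move=> XY i j; rewrite mxE; under eq_cvg do rewrite mxE; exact: cvgN. Qed.

Lemma entry_cvg_sum m n r (X : 'I_r -> nat -> 'M[R]_(m, n)) Y :
  (forall l, entry_cvg (X l) (Y l)) ->
  entry_cvg (fun k => \sum_l X l k) (\sum_l Y l).
Proof.
move=> XY i j; rewrite summxE; under eq_cvg do rewrite summxE.
by apply: (cvg_big add_continuous) => l _; exact: XY.
Qed.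

Lemma entry_cvgM m n p (X : nat -> 'M[R]_(m, n)) (X' : nat -> 'M[R]_(n, p)) Y Y' :
  entry_cvg X Y -> entry_cvg X' Y' -> entry_cvg (fun k => X k *m X' k) (Y *m Y').
Proof.
move=> XY XY' i j; rewrite mxE; under eq_cvg do rewrite mxE.
by apply: (cvg_big add_continuous) => l _; apply: cvgM; [exact: XY|exact: XY'].
Qed.

Lemma entry_cvg_tr m n (X : nat -> 'M[R]_(m, n)) Y :
  entry_cvg X Y -> entry_cvg (fun k => (X k)^T) Y^T.
Proof. by move=> XY i j; rewrite mxE; under eq_cvg do rewrite mxE; exact: XY. Qed.

Lemma entry_cvg_shift m n (X : nat -> 'M[R]_(m, n)) Y :
  entry_cvg X Y -> entry_cvg (fun k => X k.+1) Y.
Proof.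
by move=> XY i j; have := XY i j; rewrite -(cvg_shiftS (fun k => X k i j)).
Qed.

Lemma psd_entry_cvg n (X : nat -> 'M[R]_n) Y :
  (forall k, psd (X k)) -> entry_cvg X Y -> psd Y.
Proof.
move=> pX XY; split.
  apply: entry_cvg_unique (XY); have := entry_cvg_tr XY.
  by have -> : (fun k => (X k)^T) = X by apply/funext => k; exact: (pX k).1.
move=> x; have := entry_cvgM (@entry_cvg_cst _ _ x^T) XY.
move=> /entry_cvgM/(_ (@entry_cvg_cst _ _ x))/(_ 0 0) xXY; apply: (ler_cvg_to (cvg_cst 0) xXY).
by apply: nearW => k; exact: (pX k).2.
Qed.

(** Each quadratic form is a decreasing real sequence bounded below by 0; polarization recovers the
    entries. *)
Lemma psd_decreasing_cvg n (X : nat -> 'M[R]_n) :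
  (forall k, psd (X k)) -> (forall k, psd (X k - X k.+1)) ->
  exists Y, entry_cvg X Y.
Proof.
move=> pX dX.
have qcvg x : cvgn (fun k => qform (X k) x x).
  apply: nonincreasing_is_cvgn.
    apply/nonincreasing_seqP => k; rewrite -subr_ge0 -qformN -qformD.
    exact: (dX k).2.
  by exists 0 => _ [k _ <-]; exact: (pX k).2.
have ecvg i j : cvgn (fun k => X k i j).
  pose e i : 'cV[R]_n := delta_mx i 0.
  have -> : (fun k => X k i j) = (fun k => 2^-1 * (qform (X k) (e i + e j) (e i + e j)
      - qform (X k) (e i) (e i) - qform (X k) (e j) (e j))).
    apply/funext => k; have qe a b : qform (X k) (e a) (e b) = X k a b.
      by rewrite /qform trmx_delta -rowE -colE !mxE.
    have sX : X k j i = X k i j by rewrite -[in LHS](pX k).1 mxE.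
    by rewrite !(qformDl, qformDr) !qe sX; field.
  by apply: is_cvgM; [exact: is_cvg_cst|apply: is_cvgB => //; apply: is_cvgB].
exists (\matrix_(i, j) lim ((fun k => X k i j) @ \oo)) => i j; rewrite mxE.
exact: ecvg.
Qed.

End EntrywiseLimits.

(** * Uniqueness by comparison, and convergence of the iteration *)

Section RiccatiUniqueness.
Set Implicit Arguments. Unset Strict Implicit.
Variables (R : realType) (n m r : nat).
Variables (A Q : 'M[R]_n) (B L : 'M[R]_(n, m)) (Rm : 'M[R]_m).
Variables (A0 : 'I_r -> 'M[R]_n) (B0 : 'I_r -> 'M[R]_(n, m)).

Local Notation Ric := (Riccati A Q B L Rm A0 B0).
Local Notation Qt := (Qtilde Q L Rm).
Local Notation gain := (gain B L Rm A0 B0).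
Local Notation clA := (clA A B).
Local Notation clPi := (clPi A0 B0).
Local Notation cost := (cost Q L Rm).
Local Notation Phi := (Phi A Q B L Rm A0 B0).

Hypothesis posR : pd Rm.
Hypothesis posW : psd (block_mx Q L L^T Rm).
Hypothesis kerQ : assumption4 Q L Rm A0.
Hypothesis detQ : exists K : 'M[R]_n, hurwitz (A + K *m Qt).

(** On the kernel of [cost F] both [F x] and every [A0 i *m x] vanish, so [psd_dominates] applies to
    each summand of [clPi F X]; the constants add up. *)
Lemma cost_dominates F (X : 'M[R]_n) :
  psd X -> exists2 c : R, 0 <= c & psd (c *: cost F - clPi F X).
Proof.
move=> pX; have pN := cost_psd posW F.
have /choice[c hc] : forall i, exists c : R, 0 <= c /\
    psd (c *: cost F - (clA0 A0 B0 F i)^T *m X *m clA0 A0 B0 F i).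
  move=> i; have [x Nx|c c0 hc] := psd_dominates (Y := clA0 A0 B0 F i) pN pX.
    have /(cost_ker posR posW kerQ)[Fx _ A0x] : qform (cost F) x x = 0.
      by rewrite /qform -mulmxA Nx mulmx0 mxE.
    by rewrite mulmxDl -mulmxA Fx mulmx0 addr0.
  by exists c.
exists (\sum_i c i); first by rewrite sumr_ge0 // => i _; exact: (hc i).1.
rewrite scaler_suml -sumrB; apply: psd_sum => i; exact: (hc i).2.
Qed.


Lemma comparison_uniqueness F Xs D : hurwitz (clA F) -> psd Xs ->
  psd (- (lyap (clA F) Xs + clPi F Xs + cost F)) ->
  psd D -> psd (lyap (clA F) D + clPi F D) -> D = 0.
Proof.
move=> hF pXs pN pD pH.
set N := cost F in pN *.
have [c c0 hc] := cost_dominates F pD.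
have [g g0 hg] := cost_dominates F pXs.
have symcmp t : symm (t *: Xs - D).
  by rewrite /symm linearB /= linearZ /= pXs.1 pD.1.
(* [th] solves [th = (1 - th) g]: when [t] shrinks to [t th], the cost with weight [t th] covers the
   missing [t (1 - th) clPi F Xs]. *)
pose th := g / (1 + g).
have g1 : 0 < 1 + g by rewrite ltr_pwDl.
have th0 : 0 <= th by rewrite divr_ge0 // ltW.
have thg : th = (1 - th) * g by rewrite /th; field; rewrite gt_eqF.
have th1 : th < 1 by rewrite ltr_pdivrMr // mul1r ltrDr.
have cmp k : psd ((c * th ^+ k) *: Xs - D).
  elim: k => [|k IH].
    (* The constant bounding [clPi F D] by the cost serves as the first [t]. *)
    rewrite expr0 mulr1; apply: (lyapunov hF) => //.
    rewrite -/(lyap _ _) lyapD lyapN lyapZ.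
    have -> : - (c *: lyap (clA F) Xs - lyap (clA F) D) =
        c *: - (lyap (clA F) Xs + clPi F Xs + N) + c *: clPi F Xs
        + (lyap (clA F) D + clPi F D) + (c *: N - clPi F D).
      by apply/matrixP => i j; rewrite !(mxaddE, mxoppE, mxscaleE); ring.
    apply: psdD hc; apply: psdD pH; apply: psdD; apply: psdZ => //.
    exact: clPi_psd.
  set t := c * th ^+ k in IH *.
  have t0 : 0 <= t by rewrite mulr_ge0 // exprn_ge0.
  have -> : c * th ^+ k.+1 = t * th by rewrite exprSr mulrA.
  apply: (lyapunov hF) => //; rewrite -/(lyap _ _) lyapD lyapN lyapZ.
  (* The induction hypothesis enters through [clPi F (t Xs - D)]. *)
  have -> : - ((t * th) *: lyap (clA F) Xs - lyap (clA F) D) =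
      (t * th) *: - (lyap (clA F) Xs + clPi F Xs + N)
      + (lyap (clA F) D + clPi F D)
      + clPi F (t *: Xs - D) + (t * (1 - th)) *: (g *: N - clPi F Xs).
    rewrite clPiD clPiN clPiZ.
    apply/matrixP => i j; rewrite !(mxaddE, mxoppE, mxscaleE).
    by rewrite mulrBr [t * (1 - th) * (g * _)]mulrA -[t * (1 - th) * g]mulrA -thg; ring.
  apply: psdD; last by apply: psdZ => //; rewrite mulr_ge0 // subr_ge0 ltW.
  apply: psdD; last exact: clPi_psd.
  by apply: psdD => //; apply: psdZ => //; rewrite mulr_ge0.
have D0 x : qform D x x = 0.
  apply/eqP; rewrite eq_le pD.2 andbT.
  have lim0 : (fun k => c * qform Xs x x * th ^+ k) @ \oo --> (0 : R).
    by apply: cvg_geometric; rewrite ger0_norm.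
  apply: (ler_cvg_to (cvg_cst _) lim0); apply: nearW => k.
  rewrite -subr_ge0 mulrAC -qformZ -qformN -qformD; exact: (cmp k).2.
apply/matrixP => i j; have /matrixP/(_ i 0) := psd_ker pD (D0 (delta_mx j 0)).
by rewrite -colE !mxE.
Qed.

(** Subtracting [Phi (gain Xs) Xs = Ric Xs = 0] removes the cost and leaves the homogeneous
    inequality for [Y - Xs]. *)
Lemma Riccati_min_unique Xs Y : psd Xs -> Ric Xs = 0 -> psd (Y - Xs) ->
  psd (Phi (gain Xs) Y) -> Y = Xs.
Proof.
move=> pXs Xs0 pD pPhi; apply/eqP; rewrite -subr_eq0; apply/eqP.
have PhiXs : Phi (gain Xs) Xs = 0 by rewrite Phi_gain.
apply: (comparison_uniqueness (F := gain Xs) (Xs := Xs)) => //.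
- by apply: (gain_hurwitz posR posW kerQ detQ pXs); rewrite Xs0 oppr0; exact: psd0.
- by rewrite -/(Phi _ _) PhiXs oppr0; exact: psd0.
have <- : Phi (gain Xs) Y - Phi (gain Xs) Xs =
    lyap (clA (gain Xs)) (Y - Xs) + clPi (gain Xs) (Y - Xs).
  rewrite /Phi lyapD lyapN clPiD clPiN.
  by apply/matrixP => i j; rewrite !(mxaddE, mxoppE); ring.
by rewrite PhiXs subr0.
Qed.

(* Completing the square in [F - gain X] removes the gain of the iterate, so
   that no bound on these gains is needed in the limit. *)
Lemma newton_Phi_ge F X Y : psd X -> psd Y ->
  newton_step A Q B L Rm A0 B0 X Y -> let D := X - Y in
  psd (Phi F X - lyap (clA F) D + D *m B *m invmx Rm *m (D *m B)^T).
Proof.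
move=> pX pY step D; set g := gain X; set S := D *m B.
have stepE := newton_stepE pX.1 step; rewrite -/g in stepE.
have hD : D^T = D by rewrite linearB /= pX.1 pY.1.
have RicE : Ric X = lyap (clA g) D.
  by rewrite -Phi_gain // -/g lyapD lyapN stepE opprK addrA.
have [hR _] := posR; have uR := pd_unit posR.
(* Only the summand [Rm] of [Rk X] absorbs the cross terms, so the inverse in the correction does
   not depend on [X]; the [Pi22 X] part is semidefinite by itself. *)
have -> : Phi F X - lyap (clA F) D + S *m invmx Rm *m S^T =
    (F - g)^T *m Pi22 B0 X *m (F - g)
    + ((F - g) + invmx Rm *m (- S)^T)^T *m Rm *m ((F - g) + invmx Rm *m (- S)^T).
  rewrite Phi_square // RicE (lyap_clA _ _ F g hD) square_completion // -/g -/S.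
  rewrite [Rk _ _ _]/(Rm + Pi22 B0 X).
  rewrite [_ *m (Rm + _)]mulmxDr [(_ *m Rm + _) *m _]mulmxDl.
  have -> : (- S)^T = - S^T by rewrite linearN.
  rewrite !(mulmxN, mulNmx).
  by apply/matrixP => i j; rewrite !(mxaddE, mxoppE); ring.
by apply: psdD; apply: psd_congr; [exact: Pi22_psd|exact: pd_psd].
Qed.

(** The increments tend to 0, so both corrections in [newton_Phi_ge] vanish in the limit; closedness
    of the semidefinite cone gives [Phi F Y >= 0]. *)
Lemma newton_cvg Xs X : psd Xs -> Ric Xs = 0 ->
  (forall k, newton_step A Q B L Rm A0 B0 (X k) (X k.+1)) ->
  (forall k, psd (X k)) -> (forall k, psd (X k - X k.+1)) ->
  (forall k, psd (X k - Xs)) -> entry_cvg X Xs.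
Proof.
move=> pXs Xs0 step pX dX geX.
have [Y XY] := psd_decreasing_cvg pX dX.
suff <- : Y = Xs by [].
have DY : entry_cvg (fun k => X k - X k.+1) 0.
  rewrite -(subrr Y); apply: entry_cvgD => //.
  exact/entry_cvgN/entry_cvg_shift.
apply: Riccati_min_unique => //.
  apply: psd_entry_cvg geX _; apply: entry_cvgD => //; exact: entry_cvg_cst.
set F := gain Xs.
have lyap_cvg Z Z' : entry_cvg Z Z' ->
    entry_cvg (fun k => lyap (clA F) (Z k)) (lyap (clA F) Z').
  move=> ZZ'; apply: entry_cvgD; apply: entry_cvgM => //; exact: entry_cvg_cst.
have := psd_entry_cvg (fun k => newton_Phi_ge F (pX k) (pX k.+1) (step k)).
apply; have -> : Phi F Y = Phi F Y - lyap (clA F) 0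
    + 0 *m B *m invmx Rm *m (0 *m B)^T.
  by rewrite !mul0mx /lyap mulmx0 mul0mx !addr0 oppr0 addr0.
apply: entry_cvgD.
  apply: entry_cvgD; last exact/entry_cvgN/lyap_cvg.
  apply: entry_cvgD; last exact: entry_cvg_cst.
  apply: entry_cvgD; first exact: lyap_cvg.
  apply: entry_cvg_sum => i; apply: entry_cvgM; last exact: entry_cvg_cst.
  by apply: entry_cvgM => //; exact: entry_cvg_cst.
have DB : entry_cvg (fun k => (X k - X k.+1) *m B) (0 *m B).
  by apply: entry_cvgM => //; exact: entry_cvg_cst.
apply: entry_cvgM; last exact: entry_cvg_tr.
by apply: entry_cvgM => //; exact: entry_cvg_cst.
Qed.

End RiccatiUniqueness.

Theorem theoremC3 (R : realType) (n m r : nat)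
    (A Q : 'M[R]_n) (B L : 'M[R]_(n, m)) (Rm : 'M[R]_m)
    (A0 : 'I_r -> 'M[R]_n) (B0 : 'I_r -> 'M[R]_(n, m))
    (Xs X0 : 'M[R]_n) (X : nat -> 'M[R]_n) :
  assumption1 Q L Rm ->
  assumption2 A B A0 B0 ->
  assumption3 A Q B L Rm A0 B0 ->
  assumption4 Q L Rm A0 ->
  assumption5 A Q B L Rm ->
  (* X_* : the unique positive semidefinite solution of Riccati(X) = 0 *)
  psd Xs -> Riccati A Q B L Rm A0 B0 Xs = 0 ->
  (* modified Newton iteration from the symmetric X_0 *)
  symm X0 -> X 0%N = X0 ->
  (forall k, newton_step A Q B L Rm A0 B0 (X k) (X k.+1)) ->
  (forall k, psd (X k)) ->
  loewner_le Xs X0 ->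
  hurwitz (Ac A B L Rm A0 B0 X0 - Gc B Rm B0 X0 *m X0) ->
  loewner_le (Riccati A Q B L Rm A0 B0 X0) 0 ->
  ((forall k, loewner_le (X k.+1) (X k) /\ loewner_le Xs (X k) /\
              loewner_le (Riccati A Q B L Rm A0 B0 (X k)) 0)
   /\ X @ \oo --> Xs).
Proof.
move=> [posR posW] _ _ kerQ [_ detQ] pXs Xs0 _ X00 step pX geX0 _ leR0.
(* The two bounds are carried together: the sign of the residual makes the closed loop Hurwitz, on
   which the next comparison relies. *)
have inv k : psd (X k - Xs) /\ psd (- Riccati A Q B L Rm A0 B0 (X k)).
  elim: k => [|k [geXs leR]].
    by split; rewrite X00 //; move: leR0; rewrite /loewner_le sub0r.
  by have [] := newton_monotone posR posW kerQ detQ pXs Xs0 (pX k) (pX k.+1)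
    geXs leR (step k).
have decX k : psd (X k - X k.+1).
  have [geXs leR] := inv k.
  by have [] := newton_monotone posR posW kerQ detQ pXs Xs0 (pX k) (pX k.+1)
    geXs leR (step k).
split=> [k|].
  by have [geXs leR] := inv k; rewrite /loewner_le sub0r.
apply: entry_cvg_cvg; apply: (newton_cvg posR posW kerQ detQ pXs Xs0) => // k.
exact: (inv k).1.
Qed.
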